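(* For two maps $\phi_1,\phi_2:\mathbf{DS}_n\to\mathbf{DS}_n$, the following are equivalent: (1) $\operatorname{tr}(\phi_1(A)\phi_2(B))=\operatorname{tr}(AB)$ for all $A,B\in\mathbf{DS}_n$. (2) $\operatorname{spec}(\phi_1(A)\phi_2(B))=\operatorname{spec}(AB)$ for all $A,B\in\mathbf{DS}_n$. (3) There exist permutation matrices $P,Q\in\mathbf{P}_n$ such that either (a) $\phi_1(A)=PAQ^t$ and $\phi_2(A)=QAP^t$ for all $A\in\mathbf{DS}_n$, or (b) $\phi_1(A)=PA^tQ^t$ and $\phi_2(A)=QA^tP^t$ for all $A\in\mathbf{DS}_n$. If furthermore (1) or (2) holds and $\phi_1=\phi_2$, then $P=Q$ in (a) and (b).
   Context: $\mathbf{DS}_n$ is the set of $n\times n$ doubly stochastic matrices (real, entrywise nonnegative, all row sums and all column sums equal to $1$) and $\mathbf{P}_n$ is the set of $n\times n$ permutation matrices. $A^t$ is the transpose of $A$, and $\operatorname{tr}$ is the trace. $\operatorname{spec}(A)$ is the spectrum (multiset of complex eigenvalues) of $A$ counting multiplicities. The maps $\phi_1,\phi_2$ are not assumed linear.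
   Formalization: The final clause (P = Q when φ1 = φ2) is stated only for n ≠ 2: for n = 2 and S the swap matrix, φ1 = φ2 = (A ↦ SA) satisfies (1) and (2) but admits no representation (a) or (b) with P = Q. *)

(* Defs.v *)
From HB Require Import structures.
From mathcomp Require Import all_boot all_order all_algebra finmap multiset.
From mathcomp Require Import reals complex.
Set Implicit Arguments.
Unset Strict Implicit.
Unset Printing Implicit Defensive.
Import Order.TTheory GRing.Theory Num.Theory.
Local Open Scope ring_scope.

Definition doubly_stochastic (R : realType) (n : nat) (A : 'M[R]_n) : bool :=
  [&& [forall i, forall j, 0 <= A i j],
      [forall i, \sum_j A i j == 1] &
      [forall j, \sum_i A i j == 1]].

Record DS (R : realType) (n : nat) :=
  MkDS { DS_mx :> 'M[R]_n; _ : doubly_stochastic DS_mx }.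

HB.instance Definition _ (R : realType) (n : nat) := [isSub for @DS_mx R n].

(* The multiset of complex roots of the characteristic polynomial, counted with
   multiplicity: [closed_field_poly_normal p] is a sequence [r] such that
   [p = lead_coef p *: \prod_(z <- r) ('X - z%:P)]. *)
Definition spec (R : realType) (n : nat) (A : 'M[R]_n) : {mset R[i]}%mset :=
  seq_mset (sval (closed_field_poly_normal
    (char_poly (map_mx (real_complex R) A)))).

(* For n = 2 and S the swap matrix, phi1 = phi2 = (A |-> S *m A) preserves
   traces and spectra of products and has the direct form with (P, Q) = (S, 1),
   but it has neither form with P = Q because it sends the identity to S.  This
   is why the uniqueness clause P = Q of the theorem assumes n <> 2. *)
Definition form_direct (R : realType) (n : nat) (phi1 phi2 : DS R n -> DS R n)
    (P Q : 'M[R]_n) : Prop :=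
  (forall A : DS R n, phi1 A = P *m A *m Q^T :> 'M[R]_n) /\
  (forall A : DS R n, phi2 A = Q *m A *m P^T :> 'M[R]_n).

Definition form_transpose (R : realType) (n : nat)
    (phi1 phi2 : DS R n -> DS R n) (P Q : 'M[R]_n) : Prop :=
  (forall A : DS R n, phi1 A = P *m A^T *m Q^T :> 'M[R]_n) /\
  (forall A : DS R n, phi2 A = Q *m A^T *m P^T :> 'M[R]_n).

(* Main.v *)
Require Import Defs.
From mathcomp Require Import all_boot all_order all_algebra finmap multiset.
From mathcomp Require Import reals complex.
From mathcomp Require Import fingroup perm ring.
Local Open Scope ring_scope.
Set Implicit Arguments.
Unset Strict Implicit.
Unset Printing Implicit Defensive.
Import Order.TTheory GRing.Theory Num.Theory.

(** The heart of the matter is that the trace condition forces [phi1] to be an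
isometry on permutation matrices, and isometries of the symmetric group are
rigid.

If [X] and [Y] are doubly stochastic of size [n] and [tr (X Y) = n], then
[X i j * (1 - Y j i)] vanishes everywhere, which makes [X] a 0/1 matrix and
[Y] its transpose ([perm_mx_of_trace]).  Since [tr (S S^T) = n] for a
permutation matrix [S], a trace preserving pair sends permutation matrices to
permutation matrices: [phi1 S_s = S_(psi s)] and [phi2 S_s^T = S_(psi s)^T].
As [tr (S_s S_t^T)] counts the points at which [s] and [t] agree, [psi]
preserves the Hamming distance.

Let [psi] be such an isometry, with [psi 1 = 1] after a translation.  It
permutes the transpositions, which are the edges of the complete graph, and
preserves adjacency of edges.  Three edges at a common vertex could only be sent
to a triangle, but triangles are sent to triangles: the edges of a triangle are
exactly those contained in the support of a 3-cycle, and the distance sees this.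
So stars go to stars and [psi] is, on transpositions, conjugation by some
permutation ([transposition_conjugation]).  After undoing this conjugation every
3-cycle is fixed or inverted.  Which of the two happens cannot change between
two 3-cycles whose supports share two points, because agreement of orientation
along the common edge is visible in the distance; hence the choice is global
([cycle3_orientation]).  The two outcomes are the direct and the transposed form
([hamming_isometry_cycle3]).

Knowing [psi] on the identity, transpositions and 3-cycles is enough: a matrix
with zero row and column sums that is trace-orthogonal to these is zero
([eq0_of_cycle3_trace]).  So the traces against these permutations determine
[phi1 A] and [phi2 A] for every doubly stochastic [A], and neither Birkhoff's
theorem nor any linearity of the maps is involved.

The remaining implications are linear algebra: [A B] and [B A] have the same
characteristic polynomial, which together with invariance under transposition
and conjugation gives equality of spectra; the spectrum determines the
characteristic polynomial and therefore the trace.  For uniqueness, [phi1 = phi2]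
makes [S = Q^T P] satisfy [S T S = T] for all permutation matrices [T]; then [S]
is central in the symmetric group, which has trivial centre unless [n] is 2. *)

(** * Hamming distance, transpositions and 3-cycles *)

Section Hamming.
Local Open Scope nat_scope.
Local Open Scope group_scope.
Variable T : finType.
Implicit Types (s t u : {perm T}) (a b i j k l v x y z : T).

Definition moved s := [set z | s z != z].
Definition hdist s t := #|[set z | s z != t z]|.

Lemma hdist1 s : hdist s 1 = #|moved s|.
Proof. by apply: eq_card => z; rewrite !inE perm1. Qed.

Lemma hdistxx s : hdist s s = 0%N.
Proof. by apply/eqP; rewrite cards_eq0; apply/eqP/setP => z; rewrite !inE eqxx. Qed.

Lemma hdist0 s t : hdist s t = 0%N -> s = t.
Proof.
move/eqP; rewrite cards_eq0 => /eqP d0; apply/permP => z; apply/eqP.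
by move/setP/(_ z): d0; rewrite !inE => /negbFE.
Qed.

Lemma hdistMl u s t : hdist (u * s) (u * t) = hdist s t.
Proof.
rewrite /hdist -(card_preimset [set z | s z != t z] (@perm_inj _ u)).
by apply: eq_card => z; rewrite !inE !permM.
Qed.

Lemma hdistMr u s t : hdist (s * u) (t * u) = hdist s t.
Proof. by apply: eq_card => z; rewrite !inE !permM (inj_eq perm_inj). Qed.

Lemma moved_perm s z : (s z \in moved s) = (z \in moved s).
Proof. by rewrite !inE (inj_eq perm_inj). Qed.

Lemma moved_tperm x y : x != y -> moved (tperm x y) = [set x; y].
Proof.
move=> xy; apply/setP => z; rewrite !inE.
case: tpermP => [->|->|/eqP/negbTE-> /eqP/negbTE->]; rewrite ?eqxx ?orbT //.
by rewrite eq_sym.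
Qed.

(** A permutation moves its support to itself, so on a two-point support it can
only be the swap. *)
Lemma tperm_of_moved s a b : #|moved s| = 2 ->
  a \in moved s -> b \in moved s -> a != b -> s = tperm a b.
Proof.
move=> s2 sa sb ab.
have E : moved s = [set a; b].
  by apply/esym/eqP; rewrite eqEcard s2 cards2 ab subUset !sub1set sa sb.
have sab : s a = b.
  move: (sa); rewrite -moved_perm {1}E !inE; move: sa; rewrite inE.
  by move=> /negbTE-> /= /eqP.
have sba : s b = a.
  move: (sb); rewrite -moved_perm {1}E !inE; move: sb; rewrite inE.
  by move=> /negbTE-> /=; rewrite orbF => /eqP.
apply/permP => z; case: tpermP => [->|->|/eqP za /eqP zb] //.
apply/eqP; apply: contraT => sz.
have: z \in moved s by rewrite inE.
by rewrite E !inE (negbTE za) (negbTE zb).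
Qed.

Lemma transposition_at s v : #|moved s| = 2 -> v \in moved s ->
  exists2 x, v != x & s = tperm v x.
Proof.
move=> s2 sv; exists (s v); first by move: (sv); rewrite inE eq_sym.
by apply: tperm_of_moved; rewrite ?moved_perm //; move: sv; rewrite inE eq_sym.
Qed.

Lemma hdist_tperm1 i j : i != j -> hdist (tperm i j) 1 = 2.
Proof. by move=> ij; rewrite hdist1 moved_tperm // cards2 ij. Qed.

Lemma hdist_tperm2 i j k : uniq [:: i; j; k] ->
  hdist (tperm i j) (tperm i k) = 3.
Proof.
rewrite /= !inE negb_or !andbT => /andP[/andP[ij ik] jk].
rewrite /hdist (_ : [set _ | _] = k |: [set i; j]).
  by rewrite cardsU1 cards2 ij !inE negb_or eq_sym ik eq_sym jk.
apply/setP => z; rewrite !inE.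
have [->|zk] := eqVneq z k.
  by rewrite tpermR tpermD // eq_sym.
have [->|zi] := eqVneq z i; first by rewrite !tpermL jk.
have [->|zj] := eqVneq z j.
  by rewrite tpermR tpermD // eq_sym.
by rewrite !tpermD ?eqxx // eq_sym.
Qed.

Lemma hdist_disjoint s t : [disjoint moved s & moved t] ->
  hdist s t = #|moved s| + #|moved t|.
Proof.
move=> /pred0P st; have st0 : moved s :&: moved t = set0.
  by apply/setP => z; rewrite in_setI in_set0; exact: st.
rewrite -cardsUI st0 cards0 addn0; apply: eq_card => z.
move: (st z); rewrite !inE /=; have [->|] := eqVneq (s z) z.
  by rewrite eq_sym.
by move=> sz /= /negbFE/eqP->.
Qed.

(** For distinct [i], [j], [k] this is the cycle sending [i] to [j], [j] to [k]
and [k] to [i].  When some of them coincide it is a transposition or the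
identity, so the family [cycle3] covers all permutations needed below. *)
Definition cycle3 i j k : {perm T} := tperm i j * tperm i k.

Section Values.
Variables i j k : T.
Hypothesis ijk : uniq [:: i; j; k].

Let ij : i != j. Proof. by case/and3P: ijk; rewrite !inE negb_or => /andP[]. Qed.
Let ik : i != k. Proof. by case/and3P: ijk; rewrite !inE negb_or => /andP[]. Qed.
Let jk : j != k. Proof. by case/and3P: ijk; rewrite !inE. Qed.

Lemma cycle3_1 : cycle3 i j k i = j.
Proof. by rewrite permM tpermL tpermD // eq_sym. Qed.

Lemma cycle3_2 : cycle3 i j k j = k.
Proof. by rewrite permM tpermR tpermL. Qed.

Lemma cycle3_3 : cycle3 i j k k = i.
Proof. by rewrite permM [tperm i j k]tpermD // tpermR. Qed.

Lemma cycle3_out z : z \notin [:: i; j; k] -> cycle3 i j k z = z.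
Proof.
rewrite !inE !negb_or => /and3P[zi zj zk].
by rewrite permM [tperm i j z]tpermD 1?tpermD // eq_sym.
Qed.

Lemma cycle3_of_values s : s i = j -> s j = k -> s k = i ->
  (forall z, z \notin [:: i; j; k] -> s z = z) -> s = cycle3 i j k.
Proof.
move=> si sj sk so; apply/permP => z.
have [|zN] := boolP (z \in [:: i; j; k]); last by rewrite cycle3_out // so.
by rewrite !inE => /or3P[]/eqP->; rewrite ?cycle3_1 ?cycle3_2 ?cycle3_3.
Qed.

(** Knowing the image of one point orients the cycle: [s k = j] is taken by [i],
so [k] must go to [i], and then [j] to [k]. *)
Lemma cycle3_of_moved s : moved s = [set z in [:: i; j; k]] -> s i = j ->
  s = cycle3 i j k.
Proof.
move=> ms si.
have so z : z \notin [:: i; j; k] -> s z = z.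
  move=> zN; apply/eqP; apply: contraNT zN => sz.
  by have: z \in moved s by [rewrite inE]; rewrite ms inE.
have sin z : z \in [:: i; j; k] -> (s z != z) && (s z \in [:: i; j; k]).
  move=> zI; have zm : z \in moved s by rewrite ms inE.
  move: (zm); rewrite -moved_perm {1}ms inE => ->.
  by rewrite andbT; move: zm; rewrite inE.
have sk : s k = i.
  have := sin k; rewrite !inE eqxx !orbT => /(_ isT)/andP[/negbTE-> /=].
  by rewrite orbF -si (inj_eq perm_inj) [k == i]eq_sym (negbTE ik) orbF => /eqP.
have sj : s j = k.
  have := sin j; rewrite !inE eqxx !orbT => /(_ isT)/andP[/negbTE-> /=].
  by rewrite -sk (inj_eq perm_inj) (negbTE jk) => /eqP.
by exact: cycle3_of_values.
Qed.

End Values.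

Lemma uniq3_rot i j k : uniq [:: i; j; k] -> uniq [:: j; k; i].
Proof. by rewrite -(rot_uniq 1). Qed.

Lemma uniq3_swap i j k : uniq [:: i; j; k] -> uniq [:: i; k; j].
Proof. by rewrite /= !inE !negb_or !andbT andbC => /and3P[? -> ->]; rewrite eq_sym. Qed.

Lemma cycle3_rot i j k : uniq [:: i; j; k] -> cycle3 i j k = cycle3 j k i.
Proof.
move=> u; have u' := uniq3_rot u.
apply: cycle3_of_values; rewrite ?cycle3_1 ?cycle3_2 ?cycle3_3 //.
by move=> z zN; apply: cycle3_out => //; rewrite -(mem_rot 1).
Qed.

Lemma cycle3V i j k : (cycle3 i j k)^-1 = cycle3 i k j.
Proof. by rewrite invMg !tpermV. Qed.

Lemma hdist_cycle3_1 i j k : uniq [:: i; j; k] -> hdist (cycle3 i j k) 1 = 3.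
Proof.
move=> u; rewrite -(hdistMl (tperm i j)) mulgA tperm2 mul1g mulg1.
exact/hdist_tperm2/uniq3_swap.
Qed.

(** Translation invariance reduces distances from 3-cycles to distances between
transpositions, since [cycle3 i j k] is [tperm i j * tperm i k]. *)
Lemma hdist_cycle3_tperm i j k : uniq [:: i; j; k] ->
  hdist (cycle3 i j k) (tperm i j) = 2.
Proof.
move=> u; rewrite -(hdistMl (tperm i j)) mulgA tperm2 mul1g.
by apply: hdist_tperm1; case/and3P: u; rewrite !inE negb_or => /andP[].
Qed.

(** If [s] fixed [x], then [s] and [tperm x y] would differ at [x] and at the at
least two points other than [y] that [s] moves, hence at three points. *)
Lemma moved_of_hdist s x y : #|moved s| = 3 -> x != y ->
  hdist s (tperm x y) = 2 -> x \in moved s.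
Proof.
move=> s3 xy d2; rewrite inE; apply: contra_eqN d2 => /eqP sx.
rewrite neq_ltn; apply/orP; right.
have sub : x |: (moved s :\ y) \subset [set z | s z != tperm x y z].
  apply/subsetP => z; rewrite !inE => /orP[/eqP->|/andP[zy sz]].
    by rewrite sx tpermL.
  by rewrite tpermD // eq_sym //; apply: contraNneq sz => ->; rewrite sx.
apply: leq_trans (subset_leq_card sub); rewrite cardsU1 !inE sx eqxx andbF add1n ltnS.
by rewrite -(leq_add2l (y \in moved s)) -cardsD1 s3; case: (_ \in _).
Qed.

End Hamming.

(** * Isometries of the symmetric group *)

Section Isometry.
Local Open Scope nat_scope.
Local Open Scope group_scope.
Variable T : finType.
Variable psi : {perm T} -> {perm T}.
Hypothesis psi_iso : forall s t, hdist (psi s) (psi t) = hdist s t.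
Hypothesis psi1 : psi 1 = 1.
Implicit Types (s t u : {perm T}) (a b i j k l v x y z : T).

Lemma isometry_inj : injective psi.
Proof. by move=> s t st; apply: hdist0; rewrite -psi_iso st hdistxx. Qed.

Lemma card_moved_isometry s : #|moved (psi s)| = #|moved s|.
Proof. by rewrite -!hdist1 -[RHS]psi_iso psi1. Qed.

(** The edge of the complete graph onto which the edge [i j] is sent. *)
Let g i j := moved (psi (tperm i j)).

Lemma card_edge i j : i != j -> #|g i j| = 2.
Proof. by move=> ij; rewrite card_moved_isometry -hdist1 hdist_tperm1. Qed.

Lemma edge_sym i j : g i j = g j i.
Proof. by rewrite /g tpermC. Qed.

Lemma tperm_other_neq i j k : uniq [:: i; j; k] ->
  psi (tperm i j) <> psi (tperm i k).
Proof.
move=> u e; have := hdist_tperm2 u.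
by rewrite -psi_iso e hdistxx.
Qed.

Lemma uniq3P i j k : uniq [:: i; j; k] -> [/\ i != j, i != k & j != k].
Proof. by rewrite /= !inE negb_or !andbT => /andP[/andP[]]. Qed.

(** Adjacent edges are at distance 3, while the distance between disjoint
transpositions is 4. *)
Lemma edge_meet i j k : uniq [:: i; j; k] -> exists v, v \in g i j /\ v \in g i k.
Proof.
move=> u; have [ij ik jk] := uniq3P u.
have [/hdist_disjoint|] := boolP [disjoint g i j & g i k].
  by rewrite psi_iso hdist_tperm2 // !card_edge.
by case/pred0Pn => v /andP[]; exists v.
Qed.

Lemma card_moved_cycle i j k : uniq [:: i; j; k] ->
  #|moved (psi (cycle3 i j k))| = 3.
Proof. by move=> u; rewrite card_moved_isometry -hdist1 hdist_cycle3_1. Qed.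

(** The 3-cycle is at distance 2 from each transposition inside its support, and
[moved_of_hdist] reads this relation off its image: triangles are sent into
three-point sets. *)
Lemma edge_sub_cycle i j k : uniq [:: i; j; k] ->
  [/\ g i j \subset moved (psi (cycle3 i j k)),
      g j k \subset moved (psi (cycle3 i j k)) &
      g i k \subset moved (psi (cycle3 i j k))].
Proof.
have sub x y z : uniq [:: x; y; z] -> g x y \subset moved (psi (cycle3 x y z)).
  move=> u; have [xy _ _] := uniq3P u.
  apply/subsetP => v vg.
  have [w vw e] := transposition_at (card_edge xy) vg.
  apply: (moved_of_hdist (card_moved_cycle u) vw); rewrite -e psi_iso.
  exact: hdist_cycle3_tperm.
move=> u; have u1 := uniq3_rot u; have u2 := uniq3_rot u1.
split; first exact: sub.
  by rewrite (cycle3_rot u); exact: sub.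
by rewrite (cycle3_rot u) (cycle3_rot u1) edge_sym; exact: sub.
Qed.

(** Three distinct edges through [v] span four points, too many for the support
of a 3-cycle. *)
Lemma triangle_no_common_vertex i j k v : uniq [:: i; j; k] ->
  v \in g i j -> v \in g j k -> v \in g i k -> False.
Proof.
move=> u v1 v2 v3; have [ij ik jk] := uniq3P u.
have [x vx ex] := transposition_at (card_edge ij) v1.
have [y vy ey] := transposition_at (card_edge jk) v2.
have [z vz ez] := transposition_at (card_edge ik) v3.
have [s1 s2 s3] := edge_sub_cycle u.
have xy : x != y.
  apply/eqP => xy; rewrite tpermC in ex.
  by apply: (tperm_other_neq (uniq3_swap (uniq3_rot u))); rewrite tpermC ey -xy -ex tpermC.
have xz : x != z.
  by apply/eqP => xz; apply: (tperm_other_neq u); rewrite ex ez xz.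
have yz : y != z.
  apply/eqP => yz; apply: (tperm_other_neq (uniq3_rot (uniq3_rot u))).
  by rewrite tpermC ez -yz -ey tpermC.
have sub : [set w in [:: v; x; y; z]] \subset moved (psi (cycle3 i j k)).
  apply/subsetP => w; rewrite !inE => /or4P[] /eqP->.
  - by have := subsetP s1 _ v1; rewrite inE.
  - by have := subsetP s1 x; rewrite /g ex moved_tperm // !inE eqxx orbT; apply.
  - by have := subsetP s2 y; rewrite /g ey moved_tperm // !inE eqxx orbT; apply.
  - by have := subsetP s3 z; rewrite /g ez moved_tperm // !inE eqxx orbT; apply.
have := subset_leq_card sub; rewrite card_moved_cycle // cardsE.
have /card_uniqP-> // : uniq [:: v; x; y; z].
by rewrite /= !inE !negb_or vx vy vz xy xz yz.
Qed.

Lemma uniq4P i j k l : uniq [:: i; j; k; l] ->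
  [/\ i != j, i != k & i != l] /\ [/\ j != k, j != l & k != l].
Proof.
rewrite /= !inE !negb_or !andbT => /and3P[/and3P[ij ik il] /andP[jk jl] kl].
by split; split.
Qed.

(** Three pairwise meeting edges that do not share [v] form a triangle, whose
side opposite to [v] is the image of [i l].  But that side is already the image
of [j k], by [edge_sub_cycle]. *)
Lemma star_common_vertex i j k l v : uniq [:: i; j; k; l] ->
  v \in g i j -> v \in g i k -> v \in g i l.
Proof.
move=> /uniq4P[[ij ik il] [jk jl kl]] vj vk; apply: contraT => vl.
have uijk : uniq [:: i; j; k] by rewrite /= !inE negb_or ij ik jk.
have uijl : uniq [:: i; j; l] by rewrite /= !inE negb_or ij il jl.
have uikl : uniq [:: i; k; l] by rewrite /= !inE negb_or ik il kl.
have [b vb eb] := transposition_at (card_edge ij) vj.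
have [c vc ec] := transposition_at (card_edge ik) vk.
have bl : b \in g i l.
  have [w [w1 w2]] := edge_meet uijl; move: w1 w2.
  by rewrite {1}/g eb moved_tperm // in_set2 => /orP[]/eqP-> //; rewrite (negbTE vl).
have cl : c \in g i l.
  have [w [w1 w2]] := edge_meet uikl; move: w1 w2.
  by rewrite {1}/g ec moved_tperm // in_set2 => /orP[]/eqP-> //; rewrite (negbTE vl).
have bc : b != c.
  by apply/eqP => bc; apply: (tperm_other_neq uijk); rewrite eb ec bc.
have el := tperm_of_moved (card_edge il) bl cl bc.
have [s1 s2 s3] := edge_sub_cycle uijk.
have gjk : g j k = [set b; c].
  apply/eqP; rewrite eqEcard cards2 bc card_edge // andbT; apply/subsetP => w wjk.
  have wv : w != v.
    by apply: contraTneq wjk => ->; apply/negP => /(triangle_no_common_vertex uijk vj); apply.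
  have E : v |: [set b; c] = moved (psi (cycle3 i j k)).
    apply/eqP; rewrite eqEcard card_moved_cycle // cardsU1 cards2 bc !inE negb_or vb vc andbT.
    rewrite !subUset !sub1set (subsetP s1 _ vj) (subsetP s1) ?(subsetP s3) //=.
      by rewrite /g ec moved_tperm // !inE eqxx orbT.
    by rewrite /g eb moved_tperm // !inE eqxx orbT.
  by have := subsetP s2 _ wjk; rewrite -E in_setU1 (negbTE wv).
have ejk : psi (tperm j k) = tperm b c.
  by apply: tperm_of_moved; rewrite ?card_edge // -/(g j k) gjk !inE eqxx ?orbT.
have /permP/(_ j) : tperm j k = tperm i l by apply: isometry_inj; rewrite ejk el.
by rewrite tpermL tpermD // 1?eq_sym // => /eqP; rewrite eq_sym (negbTE jk).
Qed.

Lemma exists_other (s : seq T) : size s < #|T| -> exists x, x \notin s.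
Proof.
move=> sT; have /subsetPn[x _ xs] : ~~ ([set: T] \subset [set x in s]).
  apply: contraL sT => /subset_leq_card; rewrite cardsT cardsE -leqNgt => h.
  exact: leq_trans h (card_size s).
by exists x; rewrite inE in xs.
Qed.

(** The conjugating permutation sends [i] to the common vertex of the images of
the edges at [i]; two points with the same image would give a triangle whose
sides are sent to edges through one vertex. *)
Lemma transposition_conjugation :
  exists p : {perm T}, forall i j, psi (tperm i j) = tperm i j ^ p.
Proof.
suff [p pinj pP] : exists2 p : T -> T, injective p &
    forall i j, i != j -> p i \in g i j.
  exists (perm pinj) => i j; rewrite tpermJ !permE.
  have [->|ij] := eqVneq i j; first by rewrite !tperm1 psi1.
  apply: tperm_of_moved; rewrite ?(inj_eq pinj) ?card_edge //; first exact: pP.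
  by rewrite -/(g i j) edge_sym pP // eq_sym.
(* With at most two points there is at most one edge, and the star at a point
   does not single out a vertex. *)
have [T3|T2] := ltnP 2 #|T|; last first.
  exists id => // i j ij; suff /eqP -> : g i j == setT by rewrite inE.
  by rewrite eqEcard subsetT cardsT card_edge.
have /fin_all_exists[p pP] i : exists v, forall j, i != j -> v \in g i j.
  have [j] := exists_other (ltnW T3 : size [:: i] < _); rewrite inE => ji.
  have [k] := exists_other (T3 : size [:: i; j] < _); rewrite !inE negb_or => /andP[ki kj].
  have uijk : uniq [:: i; j; k].
    by rewrite /= !inE negb_or ![i == _]eq_sym ji ki eq_sym kj.
  have [v [vj vk]] := edge_meet uijk; exists v => l il.
  have [<-//|jl] := eqVneq j l; have [<-//|kl] := eqVneq k l.
  apply: star_common_vertex vj vk; move: uijk.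
  by rewrite /= !inE !negb_or jl kl il !andbT.
exists p => // i j pij; apply/eqP; apply: contraT => ij.
have [k] := exists_other (T3 : size [:: i; j] < _); rewrite !inE negb_or => /andP[ki kj].
have uijk : uniq [:: i; j; k].
  by rewrite /= !inE negb_or ij ![_ == k]eq_sym ki kj.
case: (@triangle_no_common_vertex i j k (p i) uijk); first exact: pP.
  by rewrite pij; apply: pP; rewrite eq_sym.
by apply: pP; rewrite eq_sym.
Qed.

End Isometry.

Section Orientation.
Local Open Scope nat_scope.
Local Open Scope group_scope.
Variable T : finType.
Variable psi : {perm T} -> {perm T}.
Hypothesis psi_iso : forall s t, hdist (psi s) (psi t) = hdist s t.
Hypothesis psi1 : psi 1 = 1.
Hypothesis psi_tperm : forall i j, psi (tperm i j) = tperm i j.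
Implicit Types (i j k l x y z : T).

Lemma cycle3_fixed_or_inverted i j k : uniq [:: i; j; k] ->
  psi (cycle3 i j k) = cycle3 i j k \/ psi (cycle3 i j k) = cycle3 i k j.
Proof.
move=> u; have [ij ik jk] := uniq3P u.
have [s1 s2 s3] := edge_sub_cycle psi_iso psi1 u.
have mE : moved (psi (cycle3 i j k)) = [set z in [:: i; j; k]].
  apply/esym/eqP; rewrite eqEcard card_moved_cycle // cardsE (card_uniqP u) andbT.
  apply/subsetP => z; rewrite !inE => /or3P[]/eqP->.
  - by have := subsetP s1 i; rewrite psi_tperm moved_tperm // !inE eqxx; apply.
  - by have := subsetP s1 j; rewrite psi_tperm moved_tperm // !inE eqxx orbT; apply.
  - by have := subsetP s2 k; rewrite psi_tperm moved_tperm // !inE eqxx orbT; apply.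
have im : i \in moved (psi (cycle3 i j k)) by rewrite mE !inE eqxx.
move: (im); rewrite -moved_perm mE !inE; move: im; rewrite inE => /negbTE-> /=.
case/orP => /eqP e; [left | right]; apply: cycle3_of_moved => //.
  exact: uniq3_swap.
by rewrite mE; apply/setP => z; rewrite !inE [(z == k) || _]orbC.
Qed.

Let fixed i j k := psi (cycle3 i j k) = cycle3 i j k.

Lemma cycle3_neq_inv i j k : uniq [:: i; j; k] -> cycle3 i j k <> cycle3 i k j.
Proof.
move=> u /permP/(_ i); rewrite cycle3_1 // cycle3_1; last exact: uniq3_swap.
by move/eqP; have [_ _ /negbTE->] := uniq3P u.
Qed.

Lemma fixed_rot i j k : uniq [:: i; j; k] -> fixed i j k -> fixed j k i.
Proof. by move=> u; rewrite /fixed (cycle3_rot u). Qed.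

Lemma fixed_swap i j k : uniq [:: i; j; k] -> fixed i j k -> fixed i k j.
Proof.
move=> u f; have [//|e] := cycle3_fixed_or_inverted (uniq3_swap u).
case: (cycle3_neq_inv u); apply: (isometry_inj psi_iso).
by rewrite e f.
Qed.

(** Cycles that run in the same direction along the common edge [i j] agree at
[i]; those that run in opposite directions agree at no point of their supports. *)
Lemma hdist_cycle3_edge i j k l : uniq [:: i; j; k; l] ->
  hdist (cycle3 i j k) (cycle3 i j l) = 3 /\
  hdist (cycle3 i j k) (cycle3 i l j) > 3.
Proof.
move=> u4; have [[ij ik il] [jk jl kl]] := uniq4P u4.
have uijk : uniq [:: i; j; k] by rewrite /= !inE negb_or ij ik jk.
have uijl : uniq [:: i; j; l] by rewrite /= !inE negb_or ij il jl.
have uilj := uniq3_swap uijl.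
split; first by rewrite hdistMl hdist_tperm2 //= !inE negb_or ik il kl.
rewrite -[3]/(size [:: j; k; l]) -[_.+1]/(size [:: i; j; k; l]) -(card_uniqP u4).
apply/subset_leq_card/subsetP => z; rewrite !inE => /or4P[]/eqP->.
- by rewrite !cycle3_1.
- by rewrite cycle3_2 // cycle3_3 // eq_sym.
- have kN : k \notin [:: i; l; j] by rewrite !inE !negb_or kl eq_sym ik eq_sym jk.
  by rewrite cycle3_3 // (cycle3_out kN).
- have lN : l \notin [:: i; j; k].
    by rewrite !inE !negb_or ![l == _]eq_sym il jl kl.
  by rewrite (cycle3_out lN) cycle3_2 // eq_sym.
Qed.

Lemma fixed_replace i j k l : uniq [:: i; j; k] -> uniq [:: i; j; l] ->
  fixed i j k -> fixed i j l.
Proof.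
move=> u u' f; have [<-//|kl] := eqVneq k l.
have [//|e] := cycle3_fixed_or_inverted u'.
have [|d3 d4] := @hdist_cycle3_edge i j k l.
  have [ij ik jk] := uniq3P u; have [_ il jl] := uniq3P u'.
  by rewrite /= !inE !negb_or ij ik il jk jl kl.
by move: d4; rewrite -e -{1}f psi_iso d3.
Qed.

Lemma fixed_move_first i j k a : uniq [:: i; j; k] -> fixed i j k ->
  exists j' k', uniq [:: a; j'; k'] /\ fixed a j' k'.
Proof.
move=> u f; have u1 := uniq3_rot u; have u2 := uniq3_rot u1.
have f1 := fixed_rot u f; have f2 := fixed_rot u1 f1.
have [->|ai] := eqVneq a i; first by exists j, k.
have [->|aj] := eqVneq a j; first by exists k, i.
have ua : uniq [:: i; j; a].
  by have [ij _ _] := uniq3P u; rewrite /= !inE negb_or ij eq_sym ai eq_sym aj.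
exists i, j; split; first exact/uniq3_rot/uniq3_rot.
apply/fixed_rot/fixed_rot => //; first exact: uniq3_rot.
exact: fixed_replace f.
Qed.

Lemma fixed_connected i j k a b c : uniq [:: i; j; k] -> uniq [:: a; b; c] ->
  fixed i j k -> fixed a b c.
Proof.
move=> u u' f; have [x [y [ux fx]]] := fixed_move_first a u f.
have [ab ac bc] := uniq3P u'; have [ax ay xy] := uniq3P ux.
have [bx|bx] := eqVneq b x; first by move: ux fx; rewrite -bx => /fixed_replace; apply.
have uaxb : uniq [:: a; x; b] by rewrite /= !inE negb_or ax ab eq_sym bx.
have /(fixed_swap uaxb) := fixed_replace ux uaxb fx.
exact/fixed_replace/u'/uniq3_swap.
Qed.

(** Any two triples are linked by replacing one point at a time, and each
replacement keeps the alternative between fixing and inverting. *)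
Lemma cycle3_orientation :
  (forall i j k, uniq [:: i; j; k] -> psi (cycle3 i j k) = cycle3 i j k) \/
  (forall i j k, uniq [:: i; j; k] -> psi (cycle3 i j k) = (cycle3 i j k)^-1).
Proof.
pose good (x : T * T * T) := uniq [:: x.1.1; x.1.2; x.2] &&
  (psi (cycle3 x.1.1 x.1.2 x.2) == cycle3 x.1.1 x.1.2 x.2).
have [[[i j] k] /andP[/= u /eqP f]|none] := pickP good.
  by left => a b c u'; apply: fixed_connected u' f.
right => i j k u; rewrite cycle3V.
have [e|//] := cycle3_fixed_or_inverted u.
by have := none (i, j, k); rewrite /good u e eqxx.
Qed.

End Orientation.

(** The form that Farahat's description of the isometries of the symmetric group
takes on permutations moving at most three points; the inverse is what becomes
transposition of matrices. *)
Theorem hamming_isometry_cycle3 (T : finType) (psi : {perm T} -> {perm T}) :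
    (forall s t, hdist (psi s) (psi t) = hdist s t) ->
  exists p q : {perm T},
    (forall i j k, psi (cycle3 i j k) = (p * cycle3 i j k * q)%g) \/
    (forall i j k, psi (cycle3 i j k) = (p * (cycle3 i j k)^-1 * q)%g).
Proof.
move=> iso; pose f t := ((psi 1)^-1 * psi t)%g.
have f_iso s t : hdist (f s) (f t) = hdist s t by rewrite hdistMl iso.
have f1 : f 1%g = 1%g by rewrite /f mulVg.
have [p pP] := transposition_conjugation f_iso f1.
pose h t := (f t ^ p^-1)%g.
have h_iso s t : hdist (h s) (h t) = hdist s t by rewrite hdistMl hdistMr.
have h1 : h 1%g = 1%g by rewrite /h f1 conj1g.
have hT i j : h (tperm i j) = tperm i j by rewrite /h pP conjgK.
have psiE t : psi t = (psi 1 * p^-1 * h t * p)%g.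
  by rewrite /h /f conjgE invgK !mulgA mulgKV mulgKV mulgV mul1g.
have degenerate i j k : ~~ uniq [:: i; j; k] ->
    exists a b, cycle3 i j k = tperm a b.
  rewrite /= !inE negb_and negbK negb_and negbK orbF.
  have [<-|ij] /= := eqVneq i j.
    by exists i, k; rewrite /cycle3 tperm1 mul1g.
  have [<-|ik] /= := eqVneq i k.
    by exists i, j; rewrite /cycle3 tperm1 mulg1.
  by move/eqP <-; exists i, i; rewrite /cycle3 tperm2 tperm1.
exists (psi 1%g * p^-1)%g, p.
have [hc|hc] := cycle3_orientation h_iso h1 hT; [left|right] => i j k;
  rewrite psiE; congr (_ * _ * _)%g;
  by have [/hc//|/degenerate[a [b ->]]] := boolP (uniq [:: i; j; k]);
    rewrite hT ?tpermV.
Qed.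

(** * Traces against permutation matrices *)

Section PermTrace.
Variables (R : realType) (n : nat).
Implicit Types (X Y A B D : 'M[R]_n) (s t : 'S_n).

Lemma mxtrace_mul_perm X t : \tr (X *m perm_mx t) = \sum_k X (t k) k.
Proof.
rewrite mxtrace_mulC; apply: eq_bigr => i _.
rewrite mxE (bigD1 (t i)) //= big1 ?addr0 => [|j jt].
  by rewrite !mxE eqxx mul1r.
by rewrite !mxE eq_sym (negbTE jt) mul0r.
Qed.

Lemma mxtrace_perm_hdist s t :
  \tr (perm_mx s *m (perm_mx t)^T : 'M[R]_n) + (hdist s t)%:R = n%:R.
Proof.
rewrite tr_perm_mx -perm_mxM -[perm_mx _]mul1mx mxtrace_mul_perm.
rewrite /hdist -sum1_card natr_sum [X in _ + X]big_mkcond -big_split /=.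
transitivity (\sum_(k < n) 1%:R : R); last by rewrite sumr_const card_ord.
apply: eq_bigr => k _; rewrite !mxE permM inE -[_ == k](inj_eq (@perm_inj _ t)) permKV.
by case: eqP => _; rewrite ?addr0 ?add0r.
Qed.

Lemma sum_moved_at_cycle D i j k : uniq [:: i; j; k] ->
  \sum_l D (cycle3 i j k l) l - \sum_l D l l =
  D j i + D k j + D i k - (D i i + D j j + D k k).
Proof.
move=> u; have [ij ik jk] := uniq3P u.
rewrite -sumrB (bigD1 i) // (bigD1 j) /=; last by rewrite eq_sym.
rewrite (bigD1 k) /=; last by rewrite eq_sym ik eq_sym jk.
rewrite big1 => [|l /andP[/andP[li lj] lk]].
  by rewrite cycle3_1 // cycle3_2 // cycle3_3 //; ring.
by rewrite cycle3_out ?subrr // !inE !negb_or li lj lk.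
Qed.

Lemma sum_moved_at_tperm D i j :
  \sum_l D (tperm i j l) l - \sum_l D l l = D j i + D i j - (D i i + D j j).
Proof.
have [<-|ij] := eqVneq i j.
  by rewrite tperm1; under eq_bigr do rewrite perm1; ring.
rewrite -sumrB (bigD1 i) // (bigD1 j) /=; last by rewrite eq_sym.
rewrite big1 => [|l /andP[li lj]]; first by rewrite tpermL tpermR; ring.
by rewrite tpermD ?subrr // eq_sym.
Qed.

(** Subtracting the trace of [D] from the trace against a 3-cycle leaves
[D b a + D c b + D a c = D a a + D b b + D c c], which also holds for coinciding
indices thanks to transpositions.  Summing over [c] kills the row and column
sums and gives [D b a = D a a + D b b]; the case [a = b] then yields
[D a a = 0]. *)
Lemma eq0_of_cycle3_trace D :
    (forall i, \sum_j D i j = 0) -> (forall j, \sum_i D i j = 0) ->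
    (forall i j k, \tr (D *m perm_mx (cycle3 i j k)) = 0) ->
  D = 0.
Proof.
move=> row0 col0 tr0.
have tr00 (a : 'I_n) : \sum_l D l l = 0.
  rewrite -[RHS](tr0 a a a) mxtrace_mul_perm /cycle3 tperm1 mul1g.
  by under [RHS]eq_bigr do rewrite perm1.
have key a b c : D b a + D c b + D a c = D a a + D b b + D c c.
  have trt i j : D j i + D i j = D i i + D j j.
    apply/eqP; rewrite -subr_eq0 -sum_moved_at_tperm (tr00 i) subr0.
    have := tr0 i i j; rewrite /cycle3 tperm1 mul1g mxtrace_mul_perm => ->.
    by rewrite eqxx.
  have [<-|ab] := eqVneq a b; first by rewrite -addrA trt addrA.
  have [<-|ac] := eqVneq a c; first by rewrite trt addrAC.
  have [<-|bc] := eqVneq b c; first by rewrite addrAC trt.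
  have u : uniq [:: a; b; c] by rewrite /= !inE negb_or ab ac bc.
  apply/eqP; rewrite -subr_eq0 -(sum_moved_at_cycle D u) (tr00 a) subr0.
  by rewrite -mxtrace_mul_perm tr0.
have n_neq0 (i : 'I_n) : n%:R != 0 :> R.
  by rewrite pnatr_eq0 -lt0n; case: n i => [[]|].
have diag a b : D b a = D a a + D b b.
  apply: (mulfI (n_neq0 a)).
  have : \sum_c (D b a + (D c b + D a c)) = \sum_c (D a a + D b b + D c c).
    by apply: eq_bigr => c _; rewrite addrA key.
  rewrite big_split (big_split _ _ _ (fun c => D c b)) [RHS]big_split /=.
  rewrite row0 col0 (tr00 a) !addr0 !sumr_const card_ord.
  by rewrite !mulr_natl.
have diag0 a : D a a = 0 by apply: (addrI (D a a)); rewrite addr0 -diag.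
by apply/matrixP => b a; rewrite diag !diag0 mxE addr0.
Qed.

End PermTrace.

(** * Characteristic polynomials and spectra *)

(** The block matrix [M] with blocks [x], [A], [B], [1] can be made triangular
from either side: on the right this gives [det M = det (x - A B)], on the left
[x ^+ n * det M = x ^+ n * det (x - B A)], and [x] is not a zero divisor. *)
Lemma char_poly_mulC (R : idomainType) n (A B : 'M[R]_n) :
  char_poly (A *m B) = char_poly (B *m A).
Proof.
pose x : {poly R} := 'X.
pose A' := map_mx polyC A; pose B' := map_mx polyC B.
have xn0 : x ^+ n != 0 by rewrite expf_neq0 // polyX_eq0.
apply: (mulfI xn0); rewrite /char_poly /char_poly_mx !map_mxM /= -/A' -/B' -/x.
pose M := block_mx x%:M A' B' 1%:M.
have e1 : \det M = \det (x%:M - A' *m B').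
  have : M *m block_mx 1%:M 0 (- B') 1%:M = block_mx (x%:M - A' *m B') A' 0 1%:M.
    by rewrite mulmx_block !mulmx1 !mulmx0 mulmxN mul1mx subrr !add0r.
  move/(congr1 determinant).
  by rewrite det_mulmx det_lblock det_ublock !det1 !mulr1.
rewrite -e1.
have : block_mx 1%:M 0 (- B') x%:M *m M =
       block_mx x%:M A' 0 (x%:M - B' *m A').
  rewrite mulmx_block !mul1mx !mul0mx !addr0 mulNmx.
  by rewrite mul_mx_scalar mul_scalar_mx addNr mulNmx mulmx1 addrC.
move/(congr1 determinant).
by rewrite det_mulmx det_lblock det_ublock !det1 mul1r !det_scalar.
Qed.

Lemma spec_char_poly (R : realType) n (A B : 'M[R]_n) :
  char_poly A = char_poly B -> spec A = spec B.
Proof. by move=> AB; rewrite /spec -!map_char_poly AB. Qed.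

Lemma char_poly_spec (R : realType) n (A B : 'M[R]_n) :
  spec A = spec B -> char_poly A = char_poly B.
Proof.
rewrite /spec -!map_char_poly.
case: closed_field_poly_normal => r /= rE; case: closed_field_poly_normal => r' /= rE'.
rewrite !(monicP _) ?monic_map ?char_poly_monic // !scale1r in rE rE'.
move=> rr'.
apply: (map_poly_inj (real_complex R)); rewrite rE rE'.
exact/perm_big/eq_seq_msetP.
Qed.

Lemma mxtrace_char_poly (R : nzRingType) n (A B : 'M[R]_n) :
  char_poly A = char_poly B -> \tr A = \tr B.
Proof.
case: n A B => [|n] A B AB; first by rewrite /mxtrace !big_ord0.
by apply: oppr_inj; rewrite -!char_poly_trace // AB.
Qed.

Lemma char_poly_trmx (R : comNzRingType) n (A : 'M[R]_n) :
  char_poly A^T = char_poly A.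
Proof.
rewrite /char_poly /char_poly_mx -matrix.map_trmx -[X in X - _]tr_scalar_mx.
by rewrite -linearB det_tr.
Qed.

(** * Doubly stochastic matrices *)

Section DoublyStochastic.
Variables (R : realType) (n : nat).
Implicit Types (X Y A B : 'M[R]_n) (s t : 'S_n).

Lemma doubly_stochasticP A : reflect
  [/\ forall i j, 0 <= A i j, forall i, \sum_j A i j = 1 &
      forall j, \sum_i A i j = 1]
  (doubly_stochastic A).
Proof.
apply: (iffP and3P) => -[h r c]; split.
- by move=> i j; move/forallP/(_ i)/forallP: h.
- by move=> i; exact/eqP/(forallP r).
- by move=> j; exact/eqP/(forallP c).
- by apply/forallP => i; apply/forallP => j.
- by apply/forallP => i; rewrite r.
- by apply/forallP => i; rewrite c.
Qed.

Lemma doubly_stochastic_tr A : doubly_stochastic A -> doubly_stochastic A^T.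
Proof.
case/doubly_stochasticP => h r c; apply/doubly_stochasticP; split=> i.
- by move=> j; rewrite mxE.
- by under eq_bigr do rewrite mxE.
- by under eq_bigr do rewrite mxE.
Qed.

Lemma doubly_stochastic_perm_mul s A :
  doubly_stochastic A -> doubly_stochastic (perm_mx s *m A).
Proof.
case/doubly_stochasticP => h r c; rewrite -row_permE; apply/doubly_stochasticP.
split=> [i j|i|j].
- by rewrite mxE.
- by under eq_bigr do rewrite mxE.
- by under eq_bigr do rewrite mxE; rewrite -[RHS](c j) [RHS](reindex_inj (@perm_inj _ s)).
Qed.

Lemma doubly_stochastic1 : doubly_stochastic (1%:M : 'M[R]_n).
Proof.
have r i : \sum_j (1%:M : 'M[R]_n) i j = 1.
  rewrite (bigD1 i) //= big1 ?mxE ?eqxx ?addr0 // => j ji.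
  by rewrite mxE eq_sym (negbTE ji).
apply/doubly_stochasticP; split=> // [i j|j]; first by rewrite mxE ler0n.
by rewrite -[RHS](r j); apply: eq_bigr => i _; rewrite !mxE eq_sym.
Qed.

Lemma doubly_stochastic_perm s : doubly_stochastic (perm_mx s : 'M[R]_n).
Proof.
by rewrite -[perm_mx s]mulmx1; exact/doubly_stochastic_perm_mul/doubly_stochastic1.
Qed.

Definition DS_perm s : DS R n := MkDS (doubly_stochastic_perm s).

Lemma doubly_stochastic_conj (s t : 'S_n) A : doubly_stochastic A ->
  doubly_stochastic (perm_mx s *m A *m perm_mx t).
Proof.
move=> dA; rewrite -[_ *m perm_mx t]trmxK trmx_mul tr_perm_mx.
apply/doubly_stochastic_tr/doubly_stochastic_perm_mul/doubly_stochastic_tr.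
exact: doubly_stochastic_perm_mul.
Qed.

Lemma eq_of_cycle3_trace A B : doubly_stochastic A -> doubly_stochastic B ->
    (forall i j k, \tr (A *m perm_mx (cycle3 i j k)) =
                   \tr (B *m perm_mx (cycle3 i j k))) ->
  A = B.
Proof.
move=> /doubly_stochasticP[_ rA cA] /doubly_stochasticP[_ rB cB] tAB.
apply/eqP; rewrite -subr_eq0; apply/eqP; apply: eq0_of_cycle3_trace.
- by move=> i; under eq_bigr do rewrite !mxE; rewrite sumrB rA rB subrr.
- by move=> j; under eq_bigr do rewrite !mxE; rewrite sumrB cA cB subrr.
- by move=> i j k; rewrite mulmxBl raddfB /= tAB subrr.
Qed.

(** The nonnegative numbers [X i j * (1 - Y j i)] add up to [n - tr (X Y) = 0]. *)
Lemma mulmx_entry_of_trace X Y i j :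
    doubly_stochastic X -> doubly_stochastic Y -> \tr (X *m Y) = n%:R ->
  X i j * Y j i = X i j.
Proof.
move=> /doubly_stochasticP[X0 rX _] /doubly_stochasticP[Y0 rY _] trXY.
have Y1 a b : Y a b <= 1.
  by rewrite -(rY a) (bigD1 b) //= lerDl sumr_ge0.
have nonneg a b : 0 <= X a b * (1 - Y b a) by rewrite mulr_ge0 // subr_ge0.
have : \sum_a \sum_b X a b * (1 - Y b a) = 0.
  transitivity (\sum_a ((1 : R) - (X *m Y) a a)).
    apply: eq_bigr => a _; rewrite -[X in _ = X - _](rX a) mxE -sumrB.
    by apply: eq_bigr => b _; rewrite mulrBr mulr1.
  by rewrite sumrB sumr_const card_ord -/(\tr _) trXY subrr.
move/psumr_eq0P => /(_ (fun a _ => sumr_ge0 _ (fun b _ => nonneg a b)))/(_ i isT).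
move/psumr_eq0P => /(_ (fun b _ => nonneg i b))/(_ j isT)/eqP.
by rewrite mulrBr mulr1 subr_eq0 => /eqP.
Qed.

Lemma row_entry1 X i j k : doubly_stochastic X -> X i j = 1 -> k != j -> X i k = 0.
Proof.
move=> /doubly_stochasticP[X0 rX _] X1 kj.
have := rX i; rewrite (bigD1 j) //= X1 -[RHS]addr0 => /addrI.
by move/psumr_eq0P => /(_ (fun a _ => X0 i a))/(_ k kj).
Qed.

(** [mulmx_entry_of_trace] applied to both orders of the product gives
[X i j = X i j * Y j i = Y j i], so every entry of [X] is idempotent. *)
Lemma perm_mx_of_trace X Y :
    doubly_stochastic X -> doubly_stochastic Y -> \tr (X *m Y) = n%:R ->
  exists s, X = perm_mx s /\ Y = (perm_mx s)^T.
Proof.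
move=> dX dY trXY.
have XY i j : X i j * Y j i = X i j by exact: mulmx_entry_of_trace.
have YX i j : Y j i = X i j.
  by rewrite -[RHS]XY mulrC mulmx_entry_of_trace // mxtrace_mulC.
have X01 i j : X i j = 0 \/ X i j = 1.
  have /eqP := XY i j; rewrite YX -subr_eq0 -{3}[X i j]mulr1 -mulrBr mulf_eq0.
  by rewrite subr_eq0 => /orP[]/eqP; [left|right].
have /fin_all_exists[f fP] i : exists j, X i j = 1.
  have [/existsP[j /eqP]|] := boolP [exists j, X i j == 1]; first by exists j.
  rewrite negb_exists => /forallP none; have /doubly_stochasticP[_ rX _] := dX.
  have := rX i; rewrite big1 => [/eqP|j _]; first by rewrite eq_sym oner_eq0.
  by case: (X01 i j) => // /eqP; rewrite (negbTE (none j)).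
have finj : injective f.
  move=> i i' fii; apply/eqP; apply: contraT => ii'.
  have := row_entry1 (i := f i) (j := i') (k := i) (doubly_stochastic_tr dX).
  by rewrite !mxE fP {1}fii fP => /(_ erefl ii')/eqP; rewrite oner_eq0.
have EX : X = perm_mx (perm finj).
  apply/matrixP => i j; rewrite !mxE permE.
  by have [<-//|fij] := eqVneq (f i) j; rewrite (row_entry1 dX (fP i)) // eq_sym.
exists (perm finj); split=> //; rewrite -EX.
by apply/matrixP => i j; rewrite mxE YX.
Qed.

Lemma perm_mxV_mul s : (perm_mx s)^T *m perm_mx s = 1%:M :> 'M[R]_n.
Proof. by rewrite tr_perm_mx -perm_mxM mulVg perm_mx1. Qed.

Lemma perm_mxMV s : perm_mx s *m (perm_mx s)^T = 1%:M :> 'M[R]_n.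
Proof. by rewrite tr_perm_mx -perm_mxM mulgV perm_mx1. Qed.

End DoublyStochastic.

(** * Trace and spectrum preserving pairs *)

Lemma is_perm_mxV_mul (R : realType) n (P : 'M[R]_n) : is_perm_mx P -> P^T *m P = 1%:M.
Proof. by case/is_perm_mxP => s ->; rewrite perm_mxV_mul. Qed.

Section Main.
Variables (R : realType) (n : nat) (phi1 phi2 : DS R n -> DS R n).

(** With [phi1] known on the permutations [cycle3 i j k], the traces of
[P^T (phi1 A) Q] and [Q^T (phi2 A) P] against all of these are those of [A], or
of its transpose, which determines both matrices. *)
Lemma form_of_trace_preserving :
    (forall A B : DS R n, \tr (phi1 A *m phi2 B) = \tr (A *m B)) ->
  exists P Q : 'M[R]_n, [/\ is_perm_mx P, is_perm_mx Q &
    form_direct phi1 phi2 P Q \/ form_transpose phi1 phi2 P Q].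
Proof.
move=> tr12.
have dS (A : DS R n) : doubly_stochastic A by exact: valP.
have /fin_all_exists[psi psiP] (s : 'S_n) : exists t,
    phi1 (DS_perm R s) = perm_mx t :> 'M[R]_n /\
    phi2 (DS_perm R s^-1) = (perm_mx t)^T :> 'M[R]_n.
  apply: perm_mx_of_trace => //.
  by rewrite tr12 /= -perm_mxM mulgV perm_mx1 mxtrace1.
have iso s t : hdist (psi s) (psi t) = hdist s t.
  have [e1 _] := psiP s; have [_ e2] := psiP t.
  apply/eqP; rewrite -(eqr_nat R).
  have := mxtrace_perm_hdist R (psi s) (psi t).
  rewrite -e1 -e2 tr12 /= -tr_perm_mx -(mxtrace_perm_hdist R s t).
  by move/addrI => ->.
have [p [q psiE]] := hamming_isometry_cycle3 iso.
pose P : 'M[R]_n := perm_mx p; pose Q : 'M[R]_n := (perm_mx q)^T.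
have PP : P^T *m P = 1%:M by exact: perm_mxV_mul.
have PP' : P *m P^T = 1%:M by exact: perm_mxMV.
have QQ : Q^T *m Q = 1%:M by rewrite trmxK perm_mxMV.
have QQ' : Q *m Q^T = 1%:M by rewrite trmxK perm_mxV_mul.
have Qp : Q = perm_mx q^-1 by rewrite -tr_perm_mx.
have Ptp : P^T = perm_mx p^-1 by rewrite -tr_perm_mx.
exists P, Q; split; [exact: perm_mx_is_perm | by rewrite Qp perm_mx_is_perm |].
have d1 A : doubly_stochastic (P^T *m phi1 A *m Q).
  by rewrite Ptp Qp; exact: doubly_stochastic_conj.
have d2 A : doubly_stochastic (Q^T *m phi2 A *m P).
  by rewrite /Q trmxK; exact: doubly_stochastic_conj.
have undo1 A B : P^T *m phi1 A *m Q = B -> phi1 A = P *m B *m Q^T :> 'M[R]_n.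
  by move<-; rewrite !mulmxA PP' mul1mx -mulmxA QQ' mulmx1.
have undo2 A B : Q^T *m phi2 A *m P = B -> phi2 A = Q *m B *m P^T :> 'M[R]_n.
  by move<-; rewrite !mulmxA QQ' mul1mx -mulmxA PP' mulmx1.
have tr1 (A : DS R n) s (U : 'M[R]_n) : perm_mx (psi s) = P *m U *m Q^T ->
    \tr (P^T *m phi1 A *m Q *m U^T) = \tr (A *m (perm_mx s)^T).
  move=> e; have [_ e2] := psiP s.
  rewrite tr_perm_mx -[perm_mx s^-1]/(DS_mx (DS_perm R s^-1)) -tr12 e2 e.
  by rewrite !trmx_mul trmxK !mulmxA [RHS]mxtrace_mulC !mulmxA.
have tr2 (B : DS R n) s (U : 'M[R]_n) : perm_mx (psi s) = P *m U *m Q^T ->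
    \tr (Q^T *m phi2 B *m P *m U) = \tr (B *m perm_mx s).
  move=> e; have [e1 _] := psiP s.
  rewrite [RHS]mxtrace_mulC -[perm_mx s]/(DS_mx (DS_perm R s)) -tr12 e1 e.
  by rewrite -!mulmxA mxtrace_mulC -!mulmxA [LHS]mxtrace_mulC !mulmxA.
have tr_swap (A U : 'M[R]_n) : \tr (A *m U^T) = \tr (A^T *m U).
  by rewrite -mxtrace_tr trmx_mul trmxK mxtrace_mulC.
have cycleT i j k : (perm_mx (cycle3 i k j))^T = perm_mx (cycle3 i j k) :> 'M[R]_n.
  by rewrite tr_perm_mx cycle3V.
case: psiE => psiE; [left | right].
  have psiM i j k :
      perm_mx (psi (cycle3 i j k)) = P *m perm_mx (cycle3 i j k) *m Q^T.
    by rewrite psiE !perm_mxM trmxK.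
  split=> A; [apply: undo1 | apply: undo2]; apply: eq_of_cycle3_trace => // i j k.
    by rewrite -cycleT (tr1 _ _ _ (psiM i k j)).
  exact: tr2.
have psiM i j k :
    perm_mx (psi (cycle3 i j k)) = P *m (perm_mx (cycle3 i j k))^T *m Q^T.
  by rewrite tr_perm_mx psiE !perm_mxM trmxK.
have dT (A : DS R n) : doubly_stochastic A^T by exact: doubly_stochastic_tr.
split=> A; [apply: undo1 | apply: undo2]; apply: eq_of_cycle3_trace => // i j k.
  by rewrite -[perm_mx _]trmxK (tr1 _ _ _ (psiM i j k)) trmxK tr_swap.
by rewrite -cycleT (tr2 _ _ _ (psiM i k j)) -tr_swap trmxK.
Qed.

Lemma spec_of_form (P Q : 'M[R]_n) : is_perm_mx P -> is_perm_mx Q ->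
    form_direct phi1 phi2 P Q \/ form_transpose phi1 phi2 P Q ->
  forall A B : DS R n, spec (phi1 A *m phi2 B) = spec (A *m B).
Proof.
move=> /is_perm_mxV_mul PP /is_perm_mxV_mul QQ forms A B.
apply: spec_char_poly.
have conjE (X Y : 'M[R]_n) :
    char_poly (P *m X *m Q^T *m (Q *m Y *m P^T)) = char_poly (X *m Y).
  by rewrite -!mulmxA (mulmxA Q^T) QQ mul1mx char_poly_mulC -!mulmxA PP mulmx1.
case: forms => -[-> ->]; rewrite conjE //.
by rewrite -trmx_mul char_poly_trmx char_poly_mulC.
Qed.

Lemma trace_of_spec :
    (forall A B : DS R n, spec (phi1 A *m phi2 B) = spec (A *m B)) ->
  forall A B : DS R n, \tr (phi1 A *m phi2 B) = \tr (A *m B).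
Proof. by move=> h A B; apply/mxtrace_char_poly/char_poly_spec/h. Qed.

End Main.

(** * Uniqueness *)

(** Taking [t = 1] shows that [s] is an involution, hence that it commutes with
every [t]; with a third point [k] available, [tperm (s i) k] commutes with [s]
only if [s] fixes [i]. *)
Lemma perm_involution_central n (s : 'S_n) : n <> 2 ->
  (forall t, s * t * s = t)%g -> s = 1%g.
Proof.
move=> n2 sts; have ss : (s * s)%g = 1%g by have := sts 1%g; rewrite mulg1.
have comm (t : {perm _}) i : s (t i) = t (s i).
  have /permP/(_ i) : (t * s = s * t)%g by rewrite -[in LHS](sts t) -mulgA ss mulg1.
  by rewrite !permM.
apply/permP => i; rewrite perm1; apply/eqP; apply: contraT => si.
have [|k] := @exists_other 'I_n [:: i; s i].
  rewrite card_ord /= ltn_neqAle eq_sym; apply/andP; split; first exact/eqP.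
  have : (#|[set i; s i]| <= #|'I_n|)%N by exact: max_card.
  by rewrite cards2 eq_sym si card_ord.
rewrite !inE negb_or => /andP[ki ks].
have := comm (tperm (s i) k) i; rewrite tpermL tpermD // => /eqP.
by rewrite eq_sym (negbTE ks).
Qed.

Lemma perm_mx_injective (R : nzRingType) n : injective (@perm_mx R n).
Proof.
move=> s t /matrixP st; apply/permP => i; have := st i (s i).
by rewrite !mxE eqxx; case: eqP => // _ /eqP; rewrite oner_eq0.
Qed.

Lemma perm_mx_eq_of_forms (R : realType) n (phi : DS R n -> DS R n) (P Q : 'M[R]_n) :
    n <> 2 -> is_perm_mx P -> is_perm_mx Q ->
    form_direct phi phi P Q \/ form_transpose phi phi P Q ->
  P = Q.
Proof.
move=> n2 /is_perm_mxP[p ->] /is_perm_mxP[q ->] forms.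
have PTQ t : perm_mx p *m perm_mx t *m (perm_mx q)^T =
             perm_mx q *m perm_mx t *m (perm_mx p)^T :> 'M[R]_n.
  case: forms => -[e1 e2]; first by rewrite -(e1 (DS_perm R t)) -(e2 (DS_perm R t)).
  have -> : perm_mx t = (DS_perm R t^-1)^T :> 'M[R]_n by rewrite tr_perm_mx invgK.
  by rewrite -e1 -e2.
suff /eqP : (q^-1 * p)%g = 1%g by rewrite -eq_mulVg1 => /eqP ->.
apply: perm_involution_central n2 _ => t.
have := PTQ t; rewrite !tr_perm_mx -!perm_mxM => /perm_mx_injective e.
by rewrite -[RHS](mulKg q) -[(q * t)%g](mulgK p^-1)%g -e !mulgA invgK.
Qed.

Theorem theorem3p2 (R : realType) (n : nat) (phi1 phi2 : DS R n -> DS R n) :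
  [<-> forall A B : DS R n, \tr (phi1 A *m phi2 B) = \tr (A *m B);
       forall A B : DS R n, spec (phi1 A *m phi2 B) = spec (A *m B);
       exists P Q : 'M[R]_n,
         [/\ is_perm_mx P, is_perm_mx Q &
             form_direct phi1 phi2 P Q \/ form_transpose phi1 phi2 P Q]]
  /\
  (n <> 2%N ->
   (forall A B : DS R n, \tr (phi1 A *m phi2 B) = \tr (A *m B)) \/
   (forall A B : DS R n, spec (phi1 A *m phi2 B) = spec (A *m B)) ->
   phi1 =1 phi2 ->
   forall P Q : 'M[R]_n, is_perm_mx P -> is_perm_mx Q ->
     form_direct phi1 phi2 P Q \/ form_transpose phi1 phi2 P Q -> P = Q).
Proof.
split.
  tfae.
  - by move=> /form_of_trace_preserving[P [Q [pP pQ forms]]]; exact: spec_of_form forms.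
  - by move=> /trace_of_spec/form_of_trace_preserving.
  - by case=> P [Q [pP pQ forms]]; exact/trace_of_spec/spec_of_form/forms.
move=> n2 _ phi12 P Q pP pQ forms.
apply: (@perm_mx_eq_of_forms R n phi1) => //.
by case: forms => -[e1 e2]; [left | right]; split=> // A; rewrite phi12.
Qed.
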